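(* Let $k$ be a field, $m\geqslant 1$, $(r_1,\ldots,r_m),(s_1,\ldots,s_m)\in\mathbb{Z}^m_{>1}$, and $F,G\in k[X_1,\ldots,X_m,Z,T]$ with $f(Z,T):=F(0,\ldots,0,Z,T)\neq 0$ and $g(Z,T):=G(0,\ldots,0,Z,T)\neq 0$. Suppose $\phi:A\to A'$ is a $k$-algebra isomorphism, where $$A=\frac{k[X_1,\ldots,X_m,Y,Z,T]}{\left(X_1^{r_1}\cdots X_m^{r_m}Y-F(X_1,\ldots,X_m,Z,T)\right)},\qquad A'=\frac{k[X_1,\ldots,X_m,Y,Z,T]}{\left(X_1^{s_1}\cdots X_m^{s_m}Y-G(X_1,\ldots,X_m,Z,T)\right)}.$$ Let $x_1,\ldots,x_m,y,z,t$ and $x_1',\ldots,x_m',y',z',t'$ denote the images of $X_1,\ldots,X_m,Y,Z,T$ in $A$ and $A'$ respectively. Let $E=k[x_1,\ldots,x_m]$, $E'=k[x_1',\ldots,x_m']$, $B=k[x_1,\ldots,x_m,z,t]$ and $B'=k[x_1',\ldots,x_m',z',t']$. Suppose $\operatorname{DK}(A)=B$ and $\operatorname{DK}(A')=B'$. Then: (i) $\phi$ restricts to isomorphisms from $B$ to $B'$ and from $E$ to $E'$. (ii) For each $i$, $1\leqslant i\leqslant m$, there exists $j$, $1\leqslant j\leqslant m$, such that $\phi(x_i)=\lambda_jx_j'$ for some $\lambda_j\in k^{*}$ and $r_i=s_j$. In particular, $(r_1,\ldots,r_m)=(s_1,\ldots,s_m)$ up to a permutation of $\{1,\ldots,m\}$.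 (iii) $\phi\left((x_1^{r_1}\cdots x_m^{r_m},F(x_1,\ldots,x_m,z,t))B\right)=\left((x_1')^{s_1}\cdots(x_m')^{s_m},G(x_1',\ldots,x_m',z',t')\right)B'$. (iv) There exists $\alpha\in\operatorname{Aut}_k(k[Z,T])$ such that $\alpha(g)=\lambda f$ for some $\lambda\in k^{*}$.
   Context: All rings are commutative with unity; $\mathbb{Z}^m_{>1}$ is the set of $m$-tuples of integers all greater than $1$; $B^{[1]}$ denotes a polynomial ring in one variable over $B$. Exponential maps: let $B$ be a $k$-algebra and $\phi:B\to B^{[1]}$ a $k$-algebra homomorphism; for an indeterminate $U$ over $B$ write $\phi_U:B\to B[U]$ for this map. $\phi$ is an exponential map on $B$ if (1) $\epsilon_0\phi_U=\mathrm{id}_B$, where $\epsilon_0:B[U]\to B$ is evaluation at $U=0$; and (2) $\phi_V\phi_U=\phi_{U+V}$, where $\phi_V:B\to B[V]$ is extended to a $k$-algebra homomorphism $B[U]\to B[U,V]$ by $\phi_V(U)=U$. Its ring of invariants is $B^{\phi}=\{b\in B\mid \phi(b)=b\}$. $\operatorname{EXP}(B)$ is the set of all exponential maps on $B$. The Derksen invariant $\operatorname{DK}(B)$ is the $k$-subalgebra of $B$ generated by all $b\in B^{\phi}$ with $\phi\in\operatorname{EXP}(B)$ and $B^{\phi}\subsetneqq B$. *)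

(* Defs.v *)
From HB Require Import structures.
From mathcomp Require Import all_boot all_order all_algebra.
From mathcomp Require Import ring_quotient.
From mathcomp Require Import boolp classical_sets functions.
From mathcomp Require Import mpoly.

Set Implicit Arguments.
Unset Strict Implicit.
Unset Printing Implicit Defensive.

Import GRing.Theory.

Local Open Scope classical_set_scope.
Local Open Scope ring_scope.
Local Open Scope quotient_scope.

Definition gen_subalg (k : fieldType) (A : comAlgType k) (S : set A) : set A :=
  smallest [set P : set A | GRing.subalg_closed [pred a | a \in P]] S.

(* The ideal (a, b)R of the subring R of A. *)
Definition ideal2 (k : fieldType) (A : comAlgType k) (R : set A) (a b : A) :
    set A :=
  [set c | exists u v, [/\ R u, R v & c = u * a + v * b]].

(* phi_U is a ring morphism B -> {poly B}. The library has no k-algebra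
   structure on {poly B}, hence the explicit condition on scalars.
   In {poly {poly B}} the outer variable 'X is U and the inner one
   'Y = 'X%:P is V: [map_poly phi] is the extension of phi_V fixing U, and
   [poly_XaY (phi b)] is phi_(U+V) b, i.e. phi_U b with U + V put for U. *)
Definition EXP (k : fieldType) (B : comAlgType k) :
    set {rmorphism B -> {poly B}} :=
  [set phi : {rmorphism B -> {poly B}} |
    [/\ forall c : k, phi c%:A = (c%:A)%:P,
        forall b : B, (phi b).[0] = b
      & forall b : B, map_poly phi (phi b) = poly_XaY (phi b)]].

Definition exp_inv (k : fieldType) (B : comAlgType k)
    (phi : {rmorphism B -> {poly B}}) : set B :=
  [set b | phi b = b%:P].

Definition DK (k : fieldType) (B : comAlgType k) : set B :=
  gen_subalg [set b | exists phi : {rmorphism B -> {poly B}},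
    [/\ EXP phi, exp_inv phi `<` [set: B] & exp_inv phi b]].
Arguments DK {k} B.

(* The value p(v_1, ..., v_n) of p at a point of A^n. *)
Definition poly_at (k : fieldType) (n : nat) (A : comAlgType k)
    (p : {mpoly k[n]}) (v : 'I_n -> A) : A :=
  mmap (GRing.in_alg A) v p.

(* The tuple (x_1, ..., x_m, z, t); the variables of {mpoly k[m + 2]} are
   X_1, ..., X_m, Z, T in this order. *)
Definition xzt (m : nat) (A : Type) (x : 'I_m -> A) (z t : A) :
    'I_(m + 2) -> A :=
  fun i => match fintype.split i with
           | inl j => x j
           | inr j => if j == 0 then z else t
           end.

(* The variables of {mpoly k[m + 3]} are X_1, ..., X_m, Y, Z, T. *)
Definition varX (k : fieldType) (m : nat) (i : 'I_m) : {mpoly k[m + 3]} :=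
  'X_(lshift 3 i).
Definition varY (k : fieldType) (m : nat) : {mpoly k[m + 3]} :=
  'X_(rshift m (0 : 'I_3)).
Definition varZ (k : fieldType) (m : nat) : {mpoly k[m + 3]} :=
  'X_(rshift m (1 : 'I_3)).
Definition varT (k : fieldType) (m : nat) : {mpoly k[m + 3]} :=
  'X_(rshift m (2 : 'I_3)).

Definition relator (k : fieldType) (m : nat) (r : 'I_m -> nat)
    (F : {mpoly k[m + 2]}) : {mpoly k[m + 3]} :=
  (\prod_(i < m) varX k i ^+ r i) * varY k m
  - poly_at F (xzt (varX k (m := m)) (varZ k m) (varT k m)).

Definition relator_ideal (k : fieldType) (m : nat) (r : 'I_m -> nat)
    (F : {mpoly k[m + 2]}) : {pred {mpoly k[m + 3]}} :=
  fun p => `[< exists q, p = q * relator r F >].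

Lemma poly_at_mmap (k : fieldType) (n p : nat) (A : comAlgType k)
    (F : {mpoly k[n]}) (v : 'I_n -> {mpoly k[p]}) (w : 'I_p -> A) :
  poly_at (poly_at F v) w = poly_at F (fun i => poly_at (v i) w).
Proof.
rewrite /poly_at [mmap _ v F]/mmap rmorph_sum [RHS]/mmap.
apply: eq_bigr => mu _; rewrite rmorphM /=; congr (_ * _).
  by rewrite -[in LHS]mul_mpolyC mulr1 mmapC.
by rewrite /mmap1 rmorph_prod; apply: eq_bigr => i _; rewrite rmorphXn.
Qed.

(* The relator vanishes at the point X_i = 1, Z = T = 0, Y = F(1,...,1,0,0). *)
Lemma relator_ideal_closed (k : fieldType) (m : nat) (r : 'I_m -> nat)
    (F : {mpoly k[m + 2]}) : idealr_closed (relator_ideal r F).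
Proof.
split.
- by apply/asboolP; exists 0; rewrite mul0r.
- apply/negP => /asboolP [q].
  pose c : k^o := poly_at F (xzt (fun=> 1 : k^o) 0 0).
  pose w (i : 'I_(m + 3)) : k^o :=
    match fintype.split i with inl _ => 1 | inr j => if j == 0 then c else 0 end.
  have wl i : w (lshift 3 i) = 1.
    by rewrite /w; case: fintype.splitP => j //= e; have := ltn_ord i; rewrite e -ltn_subRL subnn.
  have wr j : w (rshift m j) = if j == 0 then c else 0.
    by rewrite /w -[rshift m j]/(unsplit (inr j)) unsplitK.
  move=> /(congr1 (fun p => poly_at p w)).
  rewrite /poly_at rmorph1 rmorphM /=.
  rewrite [X in _ * X](_ : _ = 0) ?mulr0; first by move/eqP; rewrite oner_eq0.
  rewrite /relator rmorphB rmorphM rmorph_prod /= big1; last first.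
    by move=> i _; rewrite rmorphXn /= mmapX mmap1U wl expr1n.
  rewrite mul1r mmapX mmap1U wr eqxx.
  rewrite -[mmap _ w (poly_at _ _)]/(poly_at _ w) poly_at_mmap.
  apply/eqP; rewrite subr_eq0; apply/eqP; congr (mmap _ _ F).
  apply/funext => i; rewrite /xzt; case: (fintype.split i) => j.
    by rewrite /poly_at mmapX mmap1U wl.
  by case: ifP => _; rewrite /poly_at mmapX mmap1U wr.
- move=> a u v /asboolP [p ->] /asboolP [q ->]; apply/asboolP.
  by exists (a * p + q); rewrite mulrDl mulrA.
Qed.

HB.instance Definition _ (k : fieldType) (m : nat) (r : 'I_m -> nat)
    (F : {mpoly k[m + 2]}) :=
  isIdealr.Build _ (relator_ideal r F) (relator_ideal_closed r F).

Definition hyp_alg (k : fieldType) (m : nat) (r : 'I_m -> nat)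
    (F : {mpoly k[m + 2]}) : Type := {ideal_quot (relator_ideal r F)}.

Section HypAlg.
Context (k : fieldType) (m : nat) (r : 'I_m -> nat) (F : {mpoly k[m + 2]}).
Local Notation A := (hyp_alg r F).

HB.instance Definition _ :=
  GRing.ComNzRing.copy A {ideal_quot (relator_ideal r F)}.

Definition hyp_pi (p : {mpoly k[m + 3]}) : A :=
  \pi_({ideal_quot (relator_ideal r F)}) p.

Definition hyp_scale (c : k) (a : A) : A := hyp_pi c%:MP * a.

Let hyp_scaleA c d a : hyp_scale c (hyp_scale d a) = hyp_scale (c * d) a.
Proof. by rewrite /hyp_scale /hyp_pi mulrA -rmorphM /= mpolyCM. Qed.
Let hyp_scale1 : left_id 1 hyp_scale.
Proof. by move=> a; rewrite /hyp_scale /hyp_pi rmorph1 mul1r. Qed.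
Let hyp_scaleDr : right_distributive hyp_scale +%R.
Proof. by move=> c a b; rewrite /hyp_scale mulrDr. Qed.
Let hyp_scaleDl a : {morph hyp_scale^~ a : c d / c + d}.
Proof. by move=> c d; rewrite /hyp_scale /hyp_pi mpolyCD rmorphD mulrDl. Qed.

HB.instance Definition _ := GRing.Zmodule_isLmodule.Build k A
  hyp_scaleA hyp_scale1 hyp_scaleDr hyp_scaleDl.

Let hyp_scaleAl (c : k) (a b : A) : c *: (a * b) = (c *: a) * b.
Proof. exact: mulrA. Qed.

HB.instance Definition _ := GRing.Lmodule_isLalgebra.Build k A hyp_scaleAl.

Let hyp_scaleAr (c : k) (a b : A) : c *: (a * b) = a * (c *: b).
Proof. exact: mulrCA. Qed.

HB.instance Definition _ := GRing.Lalgebra_isAlgebra.Build k A hyp_scaleAr.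

Definition hyp_x (i : 'I_m) : A := hyp_pi (varX k i).
Definition hyp_y : A := hyp_pi (varY k m).
Definition hyp_z : A := hyp_pi (varZ k m).
Definition hyp_t : A := hyp_pi (varT k m).

(* k[x_1, ..., x_m] *)
Definition hyp_E : set A := gen_subalg (range hyp_x).
(* k[x_1, ..., x_m, z, t] *)
Definition hyp_B : set A :=
  gen_subalg (range hyp_x `|` [set hyp_z; hyp_t]).

(* (x_1^r_1 ... x_m^r_m, F(x_1, ..., x_m, z, t)) B *)
Definition hyp_I : set A :=
  ideal2 hyp_B (\prod_(i < m) hyp_x i ^+ r i)
               (poly_at F (xzt hyp_x hyp_z hyp_t)).

End HypAlg.
Arguments hyp_x {k m} r F i.
Arguments hyp_E {k m} r F.
Arguments hyp_B {k m} r F.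
Arguments hyp_I {k m} r F.

(* F(0, ..., 0, Z, T) *)
Definition at_X0 (k : fieldType) (m : nat) (F : {mpoly k[m + 2]}) :
    {mpoly k[2]} :=
  poly_at F (xzt (fun=> 0) 'X_0 'X_1).

(* Main.v *)
(* Let P = k[X_1, ..., X_m, Z, T].  The Derksen invariant is preserved by
   isomorphisms, so phi restricts to an isomorphism b : B -> B' of copies of P.
   A power of x^r carries phi^-1 y' into B; hence each prime X_j divides
   b (X^r)^N G, and X_j does not divide G because g <> 0.  So b (X_i) is a
   multiple of X_j for some i, which yields a permutation of the variables.
   Comparing constant and linear coefficients in y gives D A /\ B = (D, F) B
   for D = X^r, hence (iii), and (iv) is (iii) modulo X_1, ..., X_m.
   If r_i < s_j for corresponding variables, the same comparison shows that
   F mod X_i divides a monomial, so that it is a nonzero constant and x_i is a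
   unit of A.  The exponential map Z |-> Z + x^r U fixes x_i, hence 1/x_i, and
   then 1/x_i would lie in DK(A) = B. *)
Require Import Defs.
From HB Require Import structures.
From mathcomp Require Import all_boot all_order all_algebra.
From mathcomp Require Import all_fingroup.
From mathcomp Require Import boolp classical_sets functions.
From mathcomp Require Import mpoly.
From mathcomp Require Import ring_quotient ring.

Set Implicit Arguments.
Unset Strict Implicit.
Unset Printing Implicit Defensive.

Import GRing.Theory.
Local Open Scope classical_set_scope.
Local Open Scope ring_scope.

(** * Prime variables in polynomial rings *)

(** Homomorphism theorem for a quotient known only through a surjection [f]: nested kernels make the
    choice of preimages harmless. *)
Lemma rmorph_factor (R S T : nzRingType) (f : {rmorphism R -> S})
    (g : {rmorphism R -> T}) :
    (forall s, exists x, s = f x) -> (forall x, f x = 0 -> g x = 0) ->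
  exists h : {rmorphism S -> T}, forall x, h (f x) = g x.
Proof.
move=> surj ker; pose h s := g (projT1 (cid (surj s))).
have hE x : h (f x) = g x.
  rewrite /h; case: cid => x' /= fx; apply/eqP; rewrite -subr_eq0 -rmorphB.
  by apply/eqP/ker; rewrite rmorphB -fx subrr.
have hB : zmod_morphism h.
  by move=> s t; have [[x ->] [x' ->]] := (surj s, surj t); rewrite -rmorphB !hE rmorphB.
have hM : monoid_morphism h.
  split; first by rewrite -(rmorph1 f) hE rmorph1.
  by move=> s t; have [[x ->] [x' ->]] := (surj s, surj t); rewrite -rmorphM !hE rmorphM.
pose hB' := GRing.isZmodMorphism.Build S T h hB.
pose hM' := GRing.isMonoidMorphism.Build S T h hM.
pose H : {rmorphism S -> T} := HB.pack h hB' hM'.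
by exists H.
Qed.

Lemma lrmorph_inv (k : nzRingType) (A B : algType k) (f : {lrmorphism A -> B}) :
  bijective f -> exists2 g : {lrmorphism B -> A}, cancel f g & cancel g f.
Proof.
case=> g fK gK.
pose hB := GRing.isZmodMorphism.Build B A g (can2_zmod_morphism fK gK).
pose hM := GRing.isMonoidMorphism.Build B A g (can2_monoid_morphism fK gK).
pose hZ := GRing.isScalable.Build k B A *:%R g (can2_scalable fK gK).
pose H : {lrmorphism B -> A} := HB.pack g hB hM hZ.
by exists H.
Qed.

Section MpolyLift.
Context (k : fieldType) (n : nat) (S : comNzRingType).
Context (h : {rmorphism k -> S}) (v : 'I_n -> S).

Definition mpoly_lift : {rmorphism {mpoly k[n]} -> S} := mmap h v.

Lemma mpoly_liftX i : mpoly_lift 'X_i = v i.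
Proof. by rewrite /mpoly_lift /= mmapX mmap1U. Qed.

Lemma mpoly_liftC c : mpoly_lift c%:MP = h c.
Proof. by rewrite /mpoly_lift /= mmapC. Qed.

End MpolyLift.

Section PolyAt.
Context (k : fieldType) (n : nat).
Implicit Types (p : {mpoly k[n]}).

(** Congruence modulo [d] passes to sums and products, so constants and variables decide. Used with
    [d = 0], with [d] a variable, and with [d] the image of X^r. *)
Lemma mpoly_rmorph_congr (S : comNzRingType) (f g : {rmorphism {mpoly k[n]} -> S})
    (d : S) :
    (forall c, f c%:MP = g c%:MP) ->
    (forall i, exists h, f 'X_i - g 'X_i = d * h) ->
  forall p, exists h, f p - g p = d * h.
Proof.
move=> eqC eqX p.
have eqM u v : (exists h, f u - g u = d * h) -> (exists h, f v - g v = d * h) ->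
    exists h, f (u * v) - g (u * v) = d * h.
  move=> [h hu] [h' hv]; exists (h * f v + g u * h').
  by rewrite mulrDr mulrA -hu mulrCA -hv !rmorphM; ring.
elim/mpolyind: p => [|c mu p _ _ [h hp]]; first by exists 0; rewrite !rmorph0 subrr mulr0.
have [h' hmu] : exists h, f (c *: 'X_[mu]) - g (c *: 'X_[mu]) = d * h.
  rewrite -mul_mpolyC; apply: (eqM); first by exists 0; rewrite eqC subrr mulr0.
  rewrite mpolyXE_id; elim/big_rec: _ => [|i u _ IH].
    by exists 0; rewrite !rmorph1 subrr mulr0.
  apply: (eqM) => //; elim: (mu i) => [|e IHe].
    by exists 0; rewrite !expr0 !rmorph1 subrr mulr0.
  by rewrite exprS; apply: eqM.
by exists (h' + h); rewrite mulrDr -hmu -hp !rmorphD; ring.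
Qed.

Lemma mpoly_rmorph_eq (S : comNzRingType) (f g : {rmorphism {mpoly k[n]} -> S}) :
  (forall c, f c%:MP = g c%:MP) -> (forall i, f 'X_i = g 'X_i) -> f =1 g.
Proof.
move=> eqC eqX p; apply/eqP; rewrite -subr_eq0; apply/eqP.
have [|h ->] := @mpoly_rmorph_congr S f g 0 eqC _ p; last by rewrite mul0r.
by move=> i; exists 0; rewrite eqX subrr mulr0.
Qed.

Context (A : comAlgType k).

Definition mpoly_eval (v : 'I_n -> A) (p : {mpoly k[n]}) : A := poly_at p v.

HB.instance Definition _ (v : 'I_n -> A) :=
  GRing.RMorphism.copy (mpoly_eval v) (mmap (GRing.in_alg A) v).

Fact mpoly_eval_scalable (v : 'I_n -> A) : scalable (mpoly_eval v).
Proof. by move=> c p; rewrite /mpoly_eval /poly_at mmapZ /= mulr_algl. Qed.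

HB.instance Definition _ (v : 'I_n -> A) :=
  GRing.isScalable.Build k {mpoly k[n]} A *:%R (mpoly_eval v)
    (mpoly_eval_scalable v).

Lemma mpoly_evalX v i : mpoly_eval v 'X_i = v i.
Proof. by rewrite /mpoly_eval /poly_at mmapX mmap1U. Qed.

Lemma mpoly_evalC v c : mpoly_eval v c%:MP = c%:A.
Proof. by rewrite /mpoly_eval /poly_at mmapC. Qed.

Lemma lrmorph_mpolyC (f : {lrmorphism {mpoly k[n]} -> A}) c : f c%:MP = c%:A.
Proof. by rewrite -[c%:MP]mulr1 mul_mpolyC linearZ rmorph1. Qed.

Lemma mpoly_lrmorph_eq (f g : {lrmorphism {mpoly k[n]} -> A}) :
  (forall i, f 'X_i = g 'X_i) -> f =1 g.
Proof. by apply: mpoly_rmorph_eq => c /=; rewrite !lrmorph_mpolyC. Qed.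

End PolyAt.

(** * Reduction modulo a variable *)

Section PrimeVariables.
Context (k : fieldType) (n : nat).
Implicit Types (p q : {mpoly k[n]}) (i : 'I_n).

(** Reduction modulo X_i, realised inside the same ring: its kernel is (X_i) and its values lie in a
    domain, which makes X_i prime. *)
Definition kill_var i : {mpoly k[n]} -> {mpoly k[n]} :=
  mpoly_eval (fun j => if j == i then 0 else 'X_j).
HB.instance Definition _ i := GRing.LRMorphism.on (kill_var i).

Lemma kill_var_congr i p : exists q, p = 'X_i * q + kill_var i p.
Proof.
have [|j|q /eqP] := @mpoly_rmorph_congr k n _ idfun (kill_var i) 'X_i _ _ p.
- by move=> c /=; rewrite /kill_var mpoly_evalC -[RHS]mul_mpolyC mulr1.
- rewrite /= /kill_var mpoly_evalX; case: eqP => [->|_].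
    by exists 1; rewrite mulr1 subr0.
  by exists 0; rewrite mulr0 subrr.
by rewrite subr_eq => /eqP; exists q.
Qed.

Lemma kill_varX i : kill_var i 'X_i = 0.
Proof. by rewrite /kill_var mpoly_evalX eqxx. Qed.

Lemma kill_varX_neq i j : j != i -> kill_var i 'X_j = 'X_j.
Proof. by rewrite /kill_var mpoly_evalX => /negbTE ->. Qed.

Lemma mpolyX_neq0 i : 'X_i != 0 :> {mpoly k[n]}.
Proof. by rewrite -msize_poly_eq0 msizeX. Qed.

Lemma kill_var_eq0P i p : kill_var i p = 0 <-> exists q, p = 'X_i * q.
Proof.
split=> [p0|[q ->]]; last by rewrite rmorphM /= kill_varX mul0r.
by have [q] := kill_var_congr i p; rewrite p0 addr0; exists q.
Qed.

Lemma mpolyX_prime i p q r : p * q = 'X_i * r ->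
  (exists p', p = 'X_i * p') \/ (exists q', q = 'X_i * q').
Proof.
move=> /(congr1 (kill_var i)) /eqP.
rewrite !rmorphM /= kill_varX mul0r mulf_eq0 => /orP [] /eqP /kill_var_eq0P; by [left|right].
Qed.

Lemma mpoly_mul_eq1 p q : p * q = 1 -> exists2 c : k, c != 0 & p = c%:MP.
Proof.
move=> pq1.
have /andP[/eqP pE pU] : p \is a GRing.unit by apply/unitrP; exists q; rewrite mulrC pq1.
by exists p@_0; rewrite -?unitfE.
Qed.

Lemma mpolyX_prime_prod (I : finType) i (P : pred I) (u : I -> {mpoly k[n]}) r :
  \prod_(j | P j) u j = 'X_i * r -> exists j, exists q, P j /\ u j = 'X_i * q.
Proof.
move=> /(congr1 (kill_var i)) /eqP; rewrite rmorph_prod rmorphM /= kill_varX mul0r.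
case/prodf_eq0 => j Pj /eqP/kill_var_eq0P [q uE]; by exists j, q.
Qed.

Lemma mpolyX_prime_exp i p e r : p ^+ e = 'X_i * r -> exists q, p = 'X_i * q.
Proof.
move=> /(congr1 (kill_var i)) /eqP; rewrite rmorphXn rmorphM /= kill_varX mul0r.
by rewrite expf_eq0 => /andP[_ /eqP/kill_var_eq0P].
Qed.

(** No variable of the monomial divides [p], so by primality each divides the cofactor and cancels
    there; induction on the total degree ends with [p] dividing 1. *)
Lemma dvd_monomial_unit (I : finType) (P : pred I) (v : I -> 'I_n) (e : I -> nat) p q :
    (forall j q', P j -> p != 'X_(v j) * q') ->
  \prod_(j | P j) 'X_(v j) ^+ e j = p * q -> exists2 c : k, c != 0 & p = c%:MP.
Proof.
move=> pX.
suff main N : forall e q, (\sum_(j | P j) e j <= N)%N ->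
    \prod_(j | P j) 'X_(v j) ^+ e j = p * q -> exists2 c : k, c != 0 & p = c%:MP.
  exact: main (leqnn _).
elim: N => [|N IH] {}e {}q.
  rewrite leqn0 sum_nat_eq0 => /forallP e0.
  rewrite big1 => [/esym /mpoly_mul_eq1//|j Pj].
  by have := e0 j; rewrite Pj /= => /eqP ->; rewrite expr0.
move=> leN.
have [[j /andP[Pj ej]]|e0] := altP (@existsP _ (fun j => P j && (e j != 0)%N)).
  rewrite (bigD1 j) //= -(prednK (_ : 0 < e j)%N) ?lt0n // exprS -mulrA => pq.
  have [[p' pE]|[q' qE]] := mpolyX_prime (esym pq).
    by have := pX j p' Pj; rewrite pE eqxx.
  apply: (IH (fun l => if l == j then (e j).-1 else e l) q').
    rewrite (bigD1 j) //= eqxx (eq_bigr e) => [|l /andP[_ /negbTE ->] //].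
    by move: leN; rewrite (bigD1 j) //= -{1}(prednK (_ : 0 < e j)%N) ?lt0n.
  apply: (mulfI (mpolyX_neq0 (v j))); rewrite [RHS]mulrCA -qE -pq (bigD1 j) //= eqxx.
  by congr (_ * (_ * _)); apply: eq_bigr => l /andP[_ /negbTE ->].
rewrite big1 => [/esym /mpoly_mul_eq1//|j Pj].
move: e0; rewrite negb_exists => /forallP /(_ j); rewrite Pj /= negbK => /eqP ->.
by rewrite expr0.
Qed.

End PrimeVariables.

(** * Subalgebras and the Derksen invariant *)

Section Subalgebras.
Context (k : fieldType).
Implicit Types (A B : comAlgType k).

Lemma subalg_closed_setP A (P : set A) :
  GRing.subalg_closed [pred a | a \in P] <->
  [/\ P 1, forall (c : k) u v, P u -> P v -> P (c *: u + v)
    & forall u v, P u -> P v -> P (u * v)].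
Proof.
split=> [[P1 PZ PM]|[P1 PZ PM]]; split.
- exact: set_mem.
- by move=> c u v /mem_set Pu /mem_set Pv; apply/set_mem/(PZ c u v).
- by move=> u v /mem_set Pu /mem_set Pv; apply/set_mem/(PM u v).
- exact: mem_set.
- by move=> c u v /set_mem Pu /set_mem Pv; apply/mem_set/PZ.
- by move=> u v /set_mem Pu /set_mem Pv; apply/mem_set/PM.
Qed.

Lemma gen_subalg_closed A (S : set A) :
  [/\ gen_subalg S 1,
      forall (c : k) u v, gen_subalg S u -> gen_subalg S v -> gen_subalg S (c *: u + v)
    & forall u v, gen_subalg S u -> gen_subalg S v -> gen_subalg S (u * v)].
Proof.
split=> [P [/subalg_closed_setP[P1 _ _] _]//|c u v Su Sv P PS|u v Su Sv P PS];
  have [/subalg_closed_setP[_ PZ PM] _] := PS.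
- by apply: PZ; [apply: Su|apply: Sv].
- by apply: PM; [apply: Su|apply: Sv].
Qed.

Lemma sub_gen_subalg A (S : set A) : S `<=` gen_subalg S.
Proof. exact: sub_smallest. Qed.

Lemma gen_subalg_sub A (S P : set A) :
    [/\ P 1, forall (c : k) u v, P u -> P v -> P (c *: u + v)
      & forall u v, P u -> P v -> P (u * v)] ->
  S `<=` P -> gen_subalg S `<=` P.
Proof. by move=> /subalg_closed_setP PC SP; apply: smallest_sub. Qed.

Lemma gen_subalg_morph A B (f : {lrmorphism A -> B}) (S : set A) (T : set B) :
  (forall a, S a -> gen_subalg T (f a)) ->
  forall a, gen_subalg S a -> gen_subalg T (f a).
Proof.
move=> ST; apply: (gen_subalg_sub (P := f @^-1` gen_subalg T)) => //.
have [T1 TZ TM] := gen_subalg_closed T; split=> [|c u v|u v] /=.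
- by rewrite rmorph1.
- by rewrite linearP; apply: TZ.
- by rewrite rmorphM; apply: TM.
Qed.

Lemma map_poly_XaY (R S : comNzRingType) (f : {rmorphism R -> S}) (p : {poly R}) :
  map_poly (map_poly f) (poly_XaY p) = poly_XaY (map_poly f p).
Proof.
rewrite /poly_XaY map_comp_poly rmorphD /= map_polyC map_polyX /= map_polyX.
by congr (_ \Po _); rewrite -!map_poly_comp; apply: eq_map_poly => a /=; rewrite map_polyC.
Qed.

(** Transport of structure: the conjugate of [e] by [f], with [f] acting on coefficients, which
    commutes with substituting U + V for U. *)
Lemma EXP_conj A B (f : {lrmorphism A -> B}) (g : {lrmorphism B -> A})
    (e : {rmorphism A -> {poly A}}) : cancel f g -> cancel g f -> EXP e ->
  EXP (map_poly f \o (e \o g)).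
Proof.
move=> fK gK [eC e0 eD]; split=> [c|b|b] /=.
- by rewrite linearZ rmorph1 /= eC map_polyC /= linearZ rmorph1.
- have := horner_map f (e (g b)) 0; rewrite rmorph0 => ->.
  by rewrite e0 /= gK.
- rewrite -map_poly_XaY -eD -map_poly_comp -map_poly_comp.
  by apply: eq_map_poly => a /=; rewrite fK.
Qed.

Lemma DK_morph A B (f : {lrmorphism A -> B}) :
  bijective f -> forall a, DK A a -> DK B (f a).
Proof.
move=> /lrmorph_inv [g fK gK]; apply: gen_subalg_morph => a [e [eE [_ einv] ea]].
apply: sub_gen_subalg; exists (map_poly f \o (e \o g)); split=> /=.
- exact: EXP_conj.
(* If the conjugate fixed everything, so would [e]: apply [g] to the coefficients of its value at
   [f b]. *)
- split=> // einv'; apply: einv => b _.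
  have := einv' (f b) I; rewrite /exp_inv /= fK => /(congr1 (map_poly g)).
  rewrite map_polyC /= fK -map_poly_comp map_poly_id // => x _ /=.
  by rewrite fK.
- by rewrite /exp_inv /= fK ea map_polyC.
Qed.

End Subalgebras.

(** * The algebra B[Y] / (X^r Y - F) *)

Definition varx (k : fieldType) (m : nat) (i : 'I_m) : {mpoly k[m + 2]} :=
  'X_(lshift 2 i).

Definition xmon (k : fieldType) (m : nat) (r : 'I_m -> nat) : {mpoly k[m + 2]} :=
  \prod_(i < m) varx k i ^+ r i.

Section PolyValue.
Context (R S : comNzRingType) (f : {rmorphism R -> S}) (y : S).

Definition poly_value (Q : {poly R}) : S := (map_poly f Q).[y].

HB.instance Definition _ :=
  GRing.RMorphism.copy poly_value (horner_eval y \o map_poly f).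

Lemma poly_valueC a : poly_value a%:P = f a.
Proof. by rewrite /poly_value map_polyC hornerC. Qed.

Lemma poly_valueX : poly_value 'X = y.
Proof. by rewrite /poly_value map_polyX hornerX. Qed.

End PolyValue.

(* A = B[y], with B the polynomial ring, is B[Y] / (X^r Y - F). *)
Record hyp_pres (k : fieldType) (m : nat) (r : 'I_m -> nat)
    (F : {mpoly k[m + 2]}) (A : comAlgType k)
    (iota : {lrmorphism {mpoly k[m + 2]} -> A}) (y : A) : Prop := HypPres {
  pres_surj : forall a, exists Q, a = poly_value iota y Q;
  pres_ker : forall Q, poly_value iota y Q = 0 <->
    exists S, Q = S * ((xmon k r)%:P * 'X - F%:P)
}.

Section Presentation.
Context (k : fieldType) (m : nat) (r : 'I_m -> nat) (F : {mpoly k[m + 2]}).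
Context (A : comAlgType k) (iota : {lrmorphism {mpoly k[m + 2]} -> A}) (y : A).
Hypothesis presA : hyp_pres r F iota y.
Hypothesis F0 : at_X0 F != 0.
Hypothesis r_gt0 : forall i, (0 < r i)%N.

Local Notation P := {mpoly k[m + 2]}.
Local Notation ev := (poly_value iota y).

Let evC b : ev b%:P = iota b. Proof. exact: poly_valueC. Qed.
Let evX : ev 'X = y. Proof. exact: poly_valueX. Qed.

Lemma xmon_neq0 : xmon k r != 0.
Proof. by apply/prodf_neq0 => i _; rewrite expf_neq0 ?mpolyX_neq0. Qed.

Lemma xmonD1 i : xmon k r = varx k i ^+ r i * \prod_(j < m | j != i) varx k j ^+ r j.
Proof. by rewrite /xmon (bigD1 i). Qed.

Lemma pres_relation : iota (xmon k r) * y = iota F.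
Proof.
apply/eqP; rewrite -subr_eq0 -evC -(evC F).
rewrite -{2}evX -rmorphM -rmorphB; apply/eqP/(pres_ker presA).
by exists 1; rewrite mul1r.
Qed.

Lemma at_X0_varx i (q : P) : at_X0 (varx k i * q) = 0.
Proof.
rewrite -[at_X0 _]/(mpoly_eval _ _) rmorphM /= mpoly_evalX /xzt.
by rewrite -[lshift 2 i]/(unsplit (inl i)) unsplitK mul0r.
Qed.

Lemma kill_var_F i : kill_var (lshift 2 i) F != 0.
Proof.
by apply: contra_neq F0 => /kill_var_eq0P [q ->]; apply: at_X0_varx.
Qed.

(** A nonzero constant of P[Y] is no multiple of X^r Y - F, which has degree one in Y. *)
Lemma pres_inj : injective iota.
Proof.
apply/raddf_inj => b /=; rewrite -evC => /(pres_ker presA) [S SE].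
apply/eqP; apply: contraT => bn0.
have S0 : S != 0 by apply: contra_neq bn0 => S0; apply/eqP; rewrite -polyC_eq0 SE S0 mul0r.
have sz : size ((xmon k r)%:P * 'X - F%:P : {poly P}) = 2%N.
  rewrite size_polyDl ?size_Cmul ?xmon_neq0 ?size_polyX //.
  by rewrite size_polyN ltnS size_polyC leq_b1.
have := congr1 (fun p : {poly P} => size p) SE.
rewrite size_polyC bn0 size_mul // -?size_poly_gt0 sz // [(size S + _)%N]addnC addSn /= add1n.
by case => /esym/eqP; rewrite size_poly_eq0 (negbTE S0).
Qed.

(** If X_i Q = S (X^r Y - F), reduction modulo X_i gives S F = 0, as r_i > 0; since X_i does not
    divide F, it divides [S] and cancels. *)
Lemma pres_varx_reg i : injective ( *%R (iota (varx k i))).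
Proof.
suff reg0 a : iota (varx k i) * a = 0 -> a = 0.
  move=> a b /= /eqP; rewrite -subr_eq0 -mulrBr => /eqP/reg0/eqP.
  by rewrite subr_eq0 => /eqP.
have [Q ->] := pres_surj presA a.
rewrite -evC -rmorphM /= => /(pres_ker presA) [S SE].
have kS : map_poly (kill_var (lshift 2 i)) S = 0.
  have := congr1 (map_poly (kill_var (lshift 2 i))) SE.
  rewrite !rmorphM rmorphB !rmorphM /= !map_polyC map_polyX /= kill_varX mul0r.
  rewrite (xmonD1 i) rmorphM rmorphXn /= kill_varX expr0n eqn0Ngt r_gt0 !mul0r sub0r.
  move/esym/eqP; rewrite mulf_eq0 oppr_eq0 polyC_eq0 (negbTE (kill_var_F i)) orbF.
  by move/eqP.
have sE n : exists s, S`_n = varx k i * s.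
  by apply/kill_var_eq0P; rewrite -coef_map kS coef0.
(* The quotient of [S] by X_i, taken coefficient by coefficient. *)
pose S' : {poly P} := \poly_(n < size S) projT1 (cid (sE n)).
have SE' : S = (varx k i)%:P * S'.
  apply/polyP => n; rewrite coefCM coef_poly; case: ltnP => [_|/leq_sizeP -> //].
    by case: (cid _).
  by rewrite mulr0.
apply/(pres_ker presA); exists S'.
by apply: (@mulfI _ (varx k i)%:P); rewrite ?polyC_eq0 ?mpolyX_neq0 // SE {1}SE' mulrA.
Qed.

Lemma pres_xmon_reg : injective ( *%R (iota (xmon k r))).
Proof.
rewrite /xmon rmorph_prod; elim/big_rec: _ => [|i u _ IH a b]; first by move=> a b; rewrite !mul1r.
rewrite -!mulrA rmorphXn; elim: (r i) a b => [|e IHe] a b.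
  by rewrite expr0 !mul1r => /IH.
by rewrite exprS -!mulrA => /pres_varx_reg /IHe.
Qed.

(** After inverting x^r one has y = F / x^r, so each power of [y] costs one factor x^r. *)
Lemma pres_denominator a : exists N b, iota (xmon k r) ^+ N * a = iota b.
Proof.
have [Q ->] := pres_surj presA a.
elim/poly_ind: Q => [|Q c [N [b IH]]]; first by exists 0%N, 0; rewrite !rmorph0 mulr0.
exists N.+1, (b * F + xmon k r ^+ N.+1 * c).
rewrite rmorphD rmorphM /= evC evX mulrDr !rmorphD !rmorphM rmorphXn /= -pres_relation -IH.
by rewrite exprS; ring.
Qed.

(** Lift [a] to [Q]: then b - D Q is a multiple of X^r Y - F, and the constant coefficient in Y of
    such a multiple is a multiple of F. *)
Lemma pres_contract (D b : P) a : iota b = iota D * a ->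
  exists u v, b = D * u + F * v.
Proof.
have [Q ->] := pres_surj presA a.
move=> /eqP; rewrite -subr_eq0 -evC -(evC D).
rewrite -rmorphM -rmorphB => /eqP /(pres_ker presA) [S] /(congr1 (fun p : {poly P} => p`_0)).
rewrite mulrBr coefB coefC eqxx coefCM mulrA coefB coefMX eqxx sub0r coefMC => /eqP.
rewrite subr_eq => /eqP ->; exists Q`_0, (- S`_0); ring.
Qed.

(** The same comparison for the linear coefficient in Y, where X^r contributes a multiple of X_i
    because r_i > 0. *)
Lemma pres_linear_varx i u v a : iota u + iota v * y = iota (varx k i) * a ->
  exists v1 v2, v = varx k i * v1 + F * v2.
Proof.
have [Q ->] := pres_surj presA a => eqa.
have /(pres_ker presA) [S] : ev (u%:P + v%:P * 'X - (varx k i)%:P * Q) = 0.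
  by rewrite rmorphB rmorphD !rmorphM /= !evC evX eqa subrr.
move=> /(congr1 (fun p : {poly P} => p`_1)).
rewrite coefB coefD !coefCM coefC coefX /= mulr1 add0r.
rewrite mulrBr coefB mulrA coefMX /= [X in _ = X - _]coefMC [X in _ = _ - X]coefMC (xmonD1 i).
have -> : varx k i ^+ r i = varx k i * varx k i ^+ (r i).-1 by rewrite -exprS prednK.

move=> /eqP; rewrite subr_eq => /eqP ->.
set M := \prod_(j < m | _) _.
exists (S`_0 * (varx k i ^+ (r i).-1 * M) + Q`_1), (- S`_1); ring.
Qed.

(** The relation x^r y = F determines the image of [y] once the image of x^r is regular. *)
Lemma pres_rmorph_eq (T : comNzRingType) (f g : {rmorphism A -> T}) :
    (forall c : k, f c%:A = g c%:A) ->
    (forall j, f (iota 'X_j) = g (iota 'X_j)) ->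
    injective ( *%R (f (iota (xmon k r)))) ->
  f =1 g.
Proof.
move=> eqC eqX reg.
have eqi b : f (iota b) = g (iota b).
  apply: (mpoly_rmorph_eq (f := f \o iota) (g := g \o iota)) => //= c.
  by rewrite lrmorph_mpolyC.
have eqy : f y = g y.
  by apply: reg; rewrite {2}eqi -!rmorphM pres_relation.
move=> a; have [Q ->] := pres_surj presA a.
elim/poly_ind: Q => [|Q c IH]; first by rewrite !rmorph0.
by rewrite !(rmorphD, rmorphM) /= !evX !evC IH eqy eqi.
Qed.

End Presentation.

(** * An exponential map fixing x_1, ..., x_m *)

Section ExponentialMap.
Context (k : fieldType) (m : nat) (r : 'I_m -> nat) (F : {mpoly k[m + 2]}).
Context (A : comAlgType k) (iota : {lrmorphism {mpoly k[m + 2]} -> A}) (y : A).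
Hypothesis presA : hyp_pres r F iota y.
Hypothesis F0 : at_X0 F != 0.
Hypothesis r_gt0 : forall i, (0 < r i)%N.

Local Notation P := {mpoly k[m + 2]}.
Local Notation zi := (rshift m (0 : 'I_2)).
Local Notation D := (iota (xmon k r)).

Let shift_z (j : 'I_(m + 2)) : {poly A} :=
  (iota 'X_j)%:P + D%:P * (if j == zi then 'X else 0).

Let Phi : {rmorphism {mpoly k[m + 2]} -> {poly A}} :=
  mpoly_lift (polyC \o GRing.in_alg A) shift_z.

Let PhiC c : Phi c%:MP = (c%:A)%:P. Proof. exact: mpoly_liftC. Qed.
Let PhiX j : Phi 'X_j = shift_z j. Proof. exact: mpoly_liftX. Qed.

Let Phi_varx i : Phi (varx k i) = (iota (varx k i))%:P.
Proof. by rewrite PhiX /shift_z eq_lrshift mulr0 addr0. Qed.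

Let Phi_xmon : Phi (xmon k r) = D%:P.
Proof.
rewrite /xmon !rmorph_prod; apply: eq_bigr => i _.
by rewrite rmorphXn /= Phi_varx !rmorphXn.
Qed.

Let polyC_mul_reg (R : comNzRingType) (a : R) :
  injective ( *%R a) -> injective ( *%R a%:P).
Proof.
move=> reg p q /= /polyP eq; apply/polyP => i; apply: reg.
by have := eq i; rewrite !coefCM.
Qed.

(* Z |-> Z + X^r U extends to A, as F (x, z + x^r U, t) - F (x, z, t) is
   divisible by x^r. *)
Lemma exists_shift_EXP : exists e : {rmorphism A -> {poly A}},
  [/\ EXP e, exp_inv e `<` setT & forall i, exp_inv e (iota (varx k i))].
Proof.
(* [Phi] and the inclusion of constants in U agree modulo x^r on every variable, hence on [F]. *)
have [h hF] : exists h, Phi F - (iota F)%:P = D%:P * h.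
  apply: (mpoly_rmorph_congr (f := Phi) (g := polyC \o iota)) => [c|j] /=.
    by rewrite PhiC lrmorph_mpolyC.
  by rewrite PhiX /shift_z addrAC subrr add0r; eexists.
(* So [y + h] is a suitable image of [y]: with it, [ev] sends X^r Y - F to 0. *)
have rel : D%:P * (y%:P + h) = Phi F.
  by rewrite mulrDr -hF -polyCM (pres_relation presA) addrC subrK.
pose ev : {rmorphism {poly P} -> {poly A}} := poly_value Phi (y%:P + h).
have evC b : ev b%:P = Phi b by exact: poly_valueC.
have evX : ev 'X = y%:P + h by exact: poly_valueX.
have [||e eE] := @rmorph_factor _ _ _ (poly_value iota y) ev.
- exact: pres_surj presA.
- move=> Q /(pres_ker presA) [S ->]; rewrite rmorphM rmorphB rmorphM !evC evX.
  by rewrite Phi_xmon rel subrr mulr0.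
have eiota b : e (iota b) = Phi b.
  by rewrite -evC -eE; congr (e _); apply/esym; apply: poly_valueC.
have eC c : e c%:A = (c%:A)%:P.
  by rewrite -(lrmorph_mpolyC iota) eiota PhiC lrmorph_mpolyC.
have reg := pres_xmon_reg presA F0 r_gt0.
have eX i : e (iota (varx k i)) = (iota (varx k i))%:P by rewrite eiota Phi_varx.
have eD : e D = D%:P by rewrite eiota Phi_xmon.
exists e; split=> //.
  (* As x^r is fixed and regular, both axioms need only be checked on the variables of [P]. *)
  split=> // [b|b].
    apply: (pres_rmorph_eq presA (f := horner_eval 0 \o e) (g := idfun)) => [c|j|] /=.
    - by rewrite eC /horner_eval hornerC.
    - rewrite eiota PhiX /shift_z /horner_eval.
      by case: ifP => _; rewrite !(hornerE, mulr0, addr0).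
    - by rewrite eD /horner_eval hornerC.
  pose XaY : {rmorphism {poly A} -> {poly {poly A}}} :=
    comp_poly ('X + 'X%:P) \o map_poly polyC.
  apply: (pres_rmorph_eq presA (f := map_poly e \o e) (g := XaY \o e)) => [c|j|].
  - by rewrite /= eC map_polyC /= eC map_polyC /= comp_polyC.
  - rewrite /= eiota PhiX /shift_z !rmorphD !rmorphM /= !map_polyC /= !comp_polyC eD eiota PhiX /shift_z.
    case: ifP => _; rewrite ?rmorph0 ?mulr0 ?addr0 // !map_polyX comp_polyX.
    by rewrite rmorphD rmorphM /=; ring.
  - by rewrite /= eD map_polyC /= eD; do 2 apply: polyC_mul_reg.
(* The element z is moved: the coefficient of U in its image is x^r, which is nonzero, being regular
   in a nontrivial ring. *)
split=> // /(_ (iota 'X_zi) I).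
rewrite /exp_inv /= eiota PhiX /shift_z eqxx => /(congr1 (fun p : {poly A} => p`_1)).
rewrite coefD !coefC coefCM coefX /= mulr1 add0r => D0.
by have := oner_neq0 A; rewrite (reg 1 0) ?eqxx //= D0 !mul0r.
Qed.

(** The exponential map above fixes x_i, hence also an inverse of it; that inverse would lie in the
    polynomial ring, where a variable is not a unit. *)
Lemma varx_not_unit (i : 'I_m) (a : A) :
  (forall b, DK A b -> exists p, b = iota p) -> iota (varx k i) * a <> 1.
Proof.
move=> DKB xa1; have [e [eE einv eX]] := exists_shift_EXP.
have [|p ap] := DKB a.
  apply: sub_gen_subalg; exists e; split=> //=; rewrite /exp_inv /=.
  have := congr1 e xa1; rewrite rmorphM rmorph1 (eX i) => xea.
  by rewrite -[LHS]mul1r -polyC1 -xa1 mulrC polyCM mulrA [e a * _]mulrC xea mul1r.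
have /(pres_inj presA) /(congr1 (kill_var (lshift 2 i))) : iota (varx k i * p) = iota 1.
  by rewrite rmorphM /= -ap xa1 rmorph1.
by rewrite rmorphM /= kill_varX mul0r rmorph1 => /esym/eqP; rewrite oner_eq0.
Qed.

End ExponentialMap.

(** * Isomorphisms preserving the polynomial subring *)

Lemma exists_base_morph (k : fieldType) (n : nat) (A A' : comAlgType k)
    (f : {lrmorphism A -> A'}) (iota : {lrmorphism {mpoly k[n]} -> A})
    (iota' : {lrmorphism {mpoly k[n]} -> A'}) :
    (forall i, exists q, f (iota 'X_i) = iota' q) ->
  exists b : {lrmorphism {mpoly k[n]} -> {mpoly k[n]}},
    forall p, f (iota p) = iota' (b p).
Proof.
move=> fX; exists (mpoly_eval (fun i => projT1 (cid (fX i)))) => p.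
apply: (mpoly_lrmorph_eq (f := f \o iota) (g := iota' \o mpoly_eval _)) => i /=.
by rewrite mpoly_evalX; case: cid.
Qed.

Section Isomorphism.
Context (k : fieldType) (m : nat) (r s : 'I_m -> nat) (F G : {mpoly k[m + 2]}).
Context (A A' : comAlgType k).
Context (iota : {lrmorphism {mpoly k[m + 2]} -> A}) (y : A).
Context (iota' : {lrmorphism {mpoly k[m + 2]} -> A'}) (y' : A').
Hypotheses (presA : hyp_pres r F iota y) (presA' : hyp_pres s G iota' y').
Hypotheses (F0 : at_X0 F != 0) (G0 : at_X0 G != 0).
Hypotheses (r_gt0 : forall i, (0 < r i)%N) (s_gt0 : forall i, (0 < s i)%N).
Context (f : {lrmorphism A -> A'}) (g : {lrmorphism A' -> A}).
Hypotheses (fK : cancel f g) (gK : cancel g f).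
Context (b c : {lrmorphism {mpoly k[m + 2]} -> {mpoly k[m + 2]}}).
Hypotheses (fb : forall p, f (iota p) = iota' (b p)).
Hypotheses (gc : forall p, g (iota' p) = iota (c p)).

Local Notation P := {mpoly k[m + 2]}.

Lemma base_morphK : cancel b c.
Proof. by move=> p; apply: (pres_inj presA); rewrite -gc -fb fK. Qed.

(** Here c (X_j) c (q) = X_i is a factorisation of a prime: either c (q) is a constant, or c (X_j)
    is a unit and with it X_j, which is absurd. *)
Lemma base_morph_varx_assoc i j (q : P) : cancel c b -> b (varx k i) = varx k j * q ->
  exists2 l : k, l != 0 & b (varx k i) = l *: varx k j.
Proof.
move=> cK bx; have xE : c (varx k j) * c q = varx k i * 1.
  by rewrite -rmorphM /= -bx base_morphK mulr1.
have [[q' cx]|[q' cq]] := mpolyX_prime xE.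
  move: xE; rewrite cx mulr1 -mulrA -[RHS]mulr1 => /(mulfI (mpolyX_neq0 _ _)).
  rewrite mulrC => /mpoly_mul_eq1 [l l0 cqE]; exists l => //.
  by rewrite bx -[q]cK cqE lrmorph_mpolyC -scalerAr mulr1.
have : c (varx k j) * q' = 1.
  by apply: (mulfI (mpolyX_neq0 k (lshift 2 i))); rewrite mulrCA -cq xE.
move=> /(congr1 b); rewrite rmorphM rmorph1 /= cK => /(congr1 (kill_var (lshift 2 j))).
by rewrite rmorphM rmorph1 /= kill_varX mul0r => /esym/eqP; rewrite oner_eq0.
Qed.

(* A power of x^r carries g y' into B, so X_j divides b (X^r)^N G. *)
Lemma base_morph_hits_varx j : cancel c b ->
  exists i, exists2 l : k, l != 0 & b (varx k i) = l *: varx k j.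
Proof.
move=> cK; have [N [p /(congr1 f)]] := pres_denominator presA (g y').
(* In [A'] this reads b (X^r)^N y' = b (p). Multiplying by x'^s turns y' into G and leaves an
   identity of polynomials whose right side is divisible by X_j, as s_j > 0. *)
rewrite rmorphM rmorphXn /= !fb gK => /(congr1 ( *%R (iota' (xmon k s)))).
rewrite mulrCA (pres_relation presA') -rmorphXn -!rmorphM => /(pres_inj presA').
rewrite (xmonD1 k s j) -(prednK (s_gt0 j)) exprS -!mulrA => /mpolyX_prime.
case=> [[q]|[q Gq]]; last first.
  by move: (kill_var_F G0 j); rewrite Gq rmorphM /= kill_varX mul0r eqxx.
move=> /mpolyX_prime_exp [{}q]; rewrite /xmon rmorph_prod => /mpolyX_prime_prod.
case=> i [{}q] [_]; rewrite rmorphXn => /mpolyX_prime_exp [{}q] bx.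
by exists i; apply: base_morph_varx_assoc bx.
Qed.

(** Each X_j is hit from some index [t j]. Distinct variables are not associate, so [t] is
    injective, hence a permutation, and [sigma] is its inverse. *)
Lemma base_morph_perm : cancel c b -> exists sigma : 'S_m,
  forall i, exists2 l : k, l != 0 & b (varx k i) = l *: varx k (sigma i).
Proof.
move=> cK; pose t j := projT1 (cid (base_morph_hits_varx j cK)).
have tE j : exists2 l : k, l != 0 & b (varx k (t j)) = l *: varx k j.
  by rewrite /t; case: cid.
have t_inj : injective t.
  move=> j j' eqt; have [l l0 bx] := tE j; have [l' l'0] := tE j'.
  rewrite -eqt bx => /(congr1 (kill_var (lshift 2 j'))) /eqP.
  rewrite !linearZ /= kill_varX scaler0 scaler_eq0 (negbTE l0) /=.
  apply: contraTeq => neq.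
  by rewrite kill_varX_neq ?mpolyX_neq0 // (inj_eq (@lshift_inj _ _)).
exists (perm t_inj)^-1%g => i.
by have := tE ((perm t_inj)^-1%g i); rewrite -(permE t_inj) permKV.
Qed.

Lemma base_morph_xmon (sigma : 'S_m) :
    (forall i, exists2 l : k, l != 0 & b (varx k i) = l *: varx k (sigma i)) ->
    (forall i, r i = s (sigma i)) ->
  exists2 l : k, l != 0 & b (xmon k r) = l *: xmon k s.
Proof.
move=> bx rs; rewrite /xmon rmorph_prod.
rewrite [\prod_(i < m) varx k i ^+ s i](reindex_inj (@perm_inj _ sigma)) /=.
elim/big_rec2: _ => [|i q p _ [l l0 ->]]; first by exists 1; rewrite ?oner_eq0 ?scale1r.
have [l' l'0 bxi] := bx i; exists (l' ^+ r i * l); first by rewrite mulf_neq0 ?expf_neq0.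
by rewrite rmorphXn /= bxi exprZn -rs -scalerAl -scalerAr scalerA.
Qed.

(** Applying [f] to x^r y = F puts b (F) into D A', and contraction to the polynomial ring gives (D,
    G). Used with D = X^s and with D = X_j. *)
Lemma base_morph_F (D : P) (a : A') :
  f (iota (xmon k r)) = iota' D * a -> exists u v, b F = D * u + G * v.
Proof.
move=> fx; apply: (pres_contract presA' (a := a * f y)).
by rewrite mulrA -fx -rmorphM (pres_relation presA) /= fb.
Qed.

(* If r_i < s_j, then modulo x_i the polynomial F divides a monomial in the
   other variables; as F (0, Z, T) <> 0, it is a constant, and x_i is a unit. *)
Lemma exponent_leq i j (l : k) :
    (forall a, DK A a -> exists p, a = iota p) ->
    l != 0 -> b (varx k i) = l *: varx k j -> (s j <= r i)%N.
Proof.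
move=> DKB l0 bx; rewrite leqNgt; apply/negP => lt_rs.
set M := \prod_(l < m | l != i) varx k l ^+ r l.
have xr : xmon k r = varx k i ^+ r i * M := xmonD1 k r i.
have cx : c (varx k j) = l^-1 *: varx k i.
  by rewrite -[varx k i]base_morphK bx linearZ scalerA mulVf ?scale1r.
(* The image of x'^s y' = G under [g], which sends x'_j to a scalar multiple of x_i. *)
have [a0 gG] : exists a0, iota (c G) = iota (varx k i) ^+ s j * a0.
  rewrite -gc -(pres_relation presA') (xmonD1 k s j) !rmorphM !rmorphXn /= gc cx.
  rewrite linearZ exprZn -mulrA -scalerAl scalerAr; by eexists.
have gG' : iota (c G) = iota (varx k i ^+ r i) * (iota (varx k i) ^+ (s j - r i) * a0).
  by rewrite rmorphXn mulrA -exprD subnKC ?(ltnW lt_rs).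
have [u [v cG]] := pres_contract presA gG'.
(* As F = x_i^(r_i) M y in [A], cancelling x_i^(r_i) from the two expressions of c (G) leaves u + M
   v y = x_i^(s_j - r_i) a0, a multiple of x_i because r_i < s_j. *)
have [v1 [v2 vM]] : exists v1 v2, M * v = varx k i * v1 + F * v2.
  apply: (pres_linear_varx presA r_gt0 (u := u) (a := iota (varx k i) ^+ (s j - r i).-1 * a0)).
  rewrite mulrA -exprS prednK ?subn_gt0 //.
  have reg e : injective ( *%R (iota (varx k i) ^+ e)).
    elim: e => [|e IH] p q; first by rewrite expr0 !mul1r.
    by rewrite exprS -!mulrA => /(pres_varx_reg presA F0 r_gt0)/IH.
  apply: (reg (r i)); rewrite -rmorphXn -gG' cG rmorphD !rmorphM /= -(pres_relation presA) xr !rmorphM /=.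
  by ring.
(* Since r_i > 0, f (x^r) is a multiple of x'_j; so b (F) lies in (X_j, G), and [c] carries this
   back to (X_i, c (G)). *)
have [d [h cF]] : exists d h, F = varx k i * d + c G * h.
  have [|u' [v' bF]] := @base_morph_F (varx k j) (f (iota (varx k i ^+ (r i).-1 * M)) * l%:A).
    rewrite xr -{1}(prednK (r_gt0 i)) exprS -mulrA rmorphM [f _]rmorphM /= fb bx.
    by rewrite linearZ /= -scalerAl -!scalerAr mulr1 mulrC.
  exists (l^-1 *: c u'), (c v').
  by rewrite -[LHS]base_morphK bF rmorphD !rmorphM /= cx -scalerAl -scalerAr.
(* Modulo X_i the relations become F = c (G) h and M c (G) = F^2 v2; eliminating c (G) and
   cancelling F gives M = F v2 h. *)
pose K : {rmorphism P -> P} := kill_var (lshift 2 i).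
have KE p : kill_var (lshift 2 i) p = K p by [].
have Kx : K (varx k i) = 0 by exact: kill_varX.
have KM : K M = M.
  rewrite /M rmorph_prod; apply: eq_bigr => l' l'i.
  by rewrite rmorphXn -KE kill_varX_neq // (inj_eq (@lshift_inj _ _)).
have KF0 : K F != 0 := kill_var_F F0 i.
have KF : K F = K (c G) * K h by rewrite {1}cF rmorphD !rmorphM Kx mul0r add0r.
have KcG : M * K (c G) = K F * K F * K v2.
  have : M * c G = varx k i ^+ r i * (M * u) + F * (varx k i * v1 + F * v2).
    by rewrite -vM cG; ring.
  move/(congr1 K); rewrite rmorphM KM => ->.
  rewrite !(rmorphD, rmorphM) rmorphXn Kx expr0n eqn0Ngt r_gt0 /= !mul0r !add0r.
  exact: mulrA.
have Mdvd : M = K F * (K v2 * K h).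
  apply: (mulfI KF0); transitivity (M * K (c G) * K h); first by rewrite KF; ring.
  by rewrite KcG; ring.
have [|e e0 KFe] := @dvd_monomial_unit _ _ _ (fun l => l != i) (lshift 2) r _ _ _ Mdvd.
  (* If X_l' divided F modulo X_i, then F would lie in (X_i, X_l') and vanish on X = 0. *)
  move=> l' q _; apply: contra_neq F0 => KFq.
  have [w ->] := kill_var_congr (lshift 2 i) F.
  rewrite KE KFq -[at_X0 _]/(mpoly_eval _ _) rmorphD /=.
  by rewrite -![mpoly_eval _ _]/(at_X0 _) !at_X0_varx addr0.
have [w Fw] := kill_var_congr (lshift 2 i) F.
(* From x^r y = F = x_i w + e, the inverse of x_i is e^-1 (x_i^(r_i - 1) M y - w). *)
apply: (@varx_not_unit _ _ _ _ _ _ _ presA F0 r_gt0 i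
  (e^-1 *: (iota (varx k i ^+ (r i).-1 * M) * y - iota w)) DKB).
rewrite -scalerAr mulrBr mulrA -!rmorphM mulrA -exprS prednK // -xr.
rewrite (pres_relation presA) {1}Fw KE KFe rmorphD /= addrAC subrr add0r.
by rewrite lrmorph_mpolyC scalerA mulVf ?scale1r.
Qed.

End Isomorphism.

(** * The fibre over X = 0 and the presentation of the hypersurface *)

Lemma xzt_lshift (m : nat) (T : Type) (x : 'I_m -> T) z t i :
  xzt x z t (lshift 2 i) = x i.
Proof. by rewrite /xzt -[lshift 2 i]/(unsplit (inl i)) unsplitK. Qed.

Lemma xzt_rshift (m : nat) (T : Type) (x : 'I_m -> T) z t j :
  xzt x z t (rshift m j) = if j == 0 then z else t.
Proof. by rewrite /xzt -[rshift m j]/(unsplit (inr j)) unsplitK. Qed.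

Section Fibre.
Context (k : fieldType) (m : nat).
Local Notation P := {mpoly k[m + 2]}.

(** The function [at_X0] in a form that carries an algebra morphism structure; [lift0] below is a
    section of it. *)
Definition fibre0 : P -> {mpoly k[2]} := mpoly_eval (xzt (fun=> 0) 'X_0 'X_1).
HB.instance Definition _ := GRing.LRMorphism.on fibre0.

Definition lift0 : {mpoly k[2]} -> P := mpoly_eval (fun j => 'X_(rshift m j)).
HB.instance Definition _ := GRing.LRMorphism.on lift0.

Lemma fibre0_varx i : fibre0 (varx k i) = 0.
Proof. by rewrite /fibre0 mpoly_evalX xzt_lshift. Qed.

Lemma fibre0_xmon (r : 'I_m -> nat) i : (0 < r i)%N -> fibre0 (xmon k r) = 0.
Proof.
move=> ri; rewrite (xmonD1 k r i) rmorphM rmorphXn /= fibre0_varx.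
by rewrite expr0n eqn0Ngt ri mul0r.
Qed.

Lemma fibre0_rshift j : fibre0 'X_(rshift m j) = 'X_j.
Proof.
rewrite /fibre0 mpoly_evalX xzt_rshift.
by case: j => [[|[|n]] lt2] //; congr 'X_ _; apply: val_inj.
Qed.

Lemma lift0K : cancel lift0 fibre0.
Proof.
move=> p; apply: (mpoly_lrmorph_eq (f := fibre0 \o lift0) (g := idfun)) => j /=.
by rewrite /lift0 mpoly_evalX fibre0_rshift.
Qed.

(** [b] maps the ideal (X_1, ..., X_m) into itself, so it induces an endomorphism of k[Z, T]. *)
Lemma fibre0_factor (b : {lrmorphism P -> P}) :
    (forall i, exists l j, b (varx k i) = l *: varx k j) ->
  forall p, fibre0 (b (lift0 (fibre0 p))) = fibre0 (b p).
Proof.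
move=> bx p.
apply: (mpoly_lrmorph_eq (f := fibre0 \o b \o lift0 \o fibre0) (g := fibre0 \o b)).
move=> i /=; rewrite -(splitK i); case: (fintype.split i) => j /=.
  have [l [j' bj]] := bx j.
  by rewrite [fibre0 'X__]fibre0_varx [b 'X__]bj linearZ /= fibre0_varx scaler0 !rmorph0.
by rewrite fibre0_rshift /lift0 mpoly_evalX.
Qed.

End Fibre.

(** * Transport of the ideal (X^r, F) *)

Section IsomorphismIdeals.
Context (k : fieldType) (m : nat) (r s : 'I_m -> nat) (F G : {mpoly k[m + 2]}).
Context (A A' : comAlgType k).
Context (iota : {lrmorphism {mpoly k[m + 2]} -> A}) (y : A).
Context (iota' : {lrmorphism {mpoly k[m + 2]} -> A'}) (y' : A').
Hypotheses (presA : hyp_pres r F iota y) (presA' : hyp_pres s G iota' y').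
Context (f : {lrmorphism A -> A'}) (b : {lrmorphism {mpoly k[m + 2]} -> {mpoly k[m + 2]}}).
Hypothesis fb : forall p, f (iota p) = iota' (b p).
Hypothesis bx : exists2 l : k, l != 0 & b (xmon k r) = l *: xmon k s.

Lemma base_morph_F_xmon : exists u v, b F = xmon k s * u + G * v.
Proof.
have [l _ bxl] := bx; apply: (base_morph_F presA presA' fb (a := l%:A)).
by rewrite fb bxl linearZ /= -scalerAr mulr1.
Qed.

Lemma base_morph_ideal (u v : {mpoly k[m + 2]}) : exists u' v',
  f (iota u * iota (xmon k r) + iota v * iota F) =
  iota' u' * iota' (xmon k s) + iota' v' * iota' G.
Proof.
have [l _ bxl] := bx; have [u1 [v1 bF]] := base_morph_F_xmon.
exists (b u * l%:MP + b v * u1), (b v * v1).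
rewrite rmorphD !rmorphM /= !fb bF bxl -mul_mpolyC !(rmorphD, rmorphM) /=; ring.
Qed.

End IsomorphismIdeals.

(** * The induced automorphism of k[Z, T] *)

Section FibreIsomorphism.
Context (k : fieldType) (m : nat) (F G : {mpoly k[m + 2]}).
Context (b c : {lrmorphism {mpoly k[m + 2]} -> {mpoly k[m + 2]}}).
Hypotheses (bK : cancel b c) (cK : cancel c b).
Hypothesis bx : forall i, exists l j, b (varx k i) = l *: varx k j.
Hypothesis cx : forall i, exists l j, c (varx k i) = l *: varx k j.
Hypothesis F0 : at_X0 F != 0.
Hypothesis bF : exists v, fibre0 (b F) = fibre0 G * v.
Hypothesis cG : exists v, fibre0 (c G) = fibre0 F * v.

(** The reductions [alpha] of [c] and [beta] of [b] are inverse to each other. From alpha (g) = f v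
    and beta (f) = g w it follows that v is a unit of k[Z, T], that is, a nonzero constant. *)
Lemma fibre_automorphism :
  exists2 alpha : {lrmorphism {mpoly k[2]} -> {mpoly k[2]}},
    bijective alpha &
    exists2 lambda : k, lambda != 0 & alpha (at_X0 G) = lambda *: at_X0 F.
Proof.
pose alpha : {lrmorphism {mpoly k[2]} -> {mpoly k[2]}} := @fibre0 k m \o c \o @lift0 k m.
pose beta : {lrmorphism {mpoly k[2]} -> {mpoly k[2]}} := @fibre0 k m \o b \o @lift0 k m.
exists alpha.
  exists beta => p; rewrite /alpha /beta /=.
    by rewrite (fibre0_factor bx) cK lift0K.
  by rewrite (fibre0_factor cx) bK lift0K.
have alphaE p : alpha (fibre0 p) = fibre0 (c p) by exact: fibre0_factor.
have [v cGv] := cG; have [w bFw] := bF.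
have [e e0 vE] : exists2 e : k, e != 0 & v = e%:MP.
  (* Cancel f in f v alpha (w) = alpha (g w) = alpha (beta (f)) = f. *)
  apply: (mpoly_mul_eq1 (q := alpha w)); apply: (mulfI F0).
  rewrite mulr1 mulrA -[at_X0 F]/(fibre0 F) -cGv -alphaE -rmorphM -bFw.
  by rewrite [LHS](alphaE (b F)) bK.
exists e => //; rewrite -[at_X0 G]/(fibre0 G) alphaE cGv vE mulrC.
exact: mul_mpolyC.
Qed.

End FibreIsomorphism.

(** * The hypersurface algebra as a quotient of P[Y] *)

Section HypersurfacePresentation.
Context (k : fieldType) (m : nat) (r : 'I_m -> nat) (F : {mpoly k[m + 2]}).
Local Notation A := (hyp_alg r F).
Local Notation P := {mpoly k[m + 2]}.
Local Notation R := {mpoly k[m + 3]}.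

HB.instance Definition _ := GRing.RMorphism.copy (@hyp_pi k m r F)
  (\pi_({ideal_quot (relator_ideal r F)})%qT : R -> {ideal_quot (relator_ideal r F)}).

Fact hyp_pi_scalable : scalable (@hyp_pi k m r F).
Proof. by move=> d p; rewrite -mul_mpolyC rmorphM. Qed.

HB.instance Definition _ :=
  GRing.isScalable.Build k R A *:%R (@hyp_pi k m r F) hyp_pi_scalable.

Lemma hyp_pi_eq0 (p : R) : hyp_pi r F p = 0 <-> exists q, p = q * relator r F.
Proof.
rewrite -(rmorph0 (hyp_pi r F)); split => [/eqP|[q ->]].
  by rewrite /hyp_pi -[X in is_true X]Quotient.idealrBE subr0 => /asboolP.
by apply/eqP; rewrite /hyp_pi -Quotient.idealrBE subr0; apply/asboolP; exists q.
Qed.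

Lemma hyp_pi_surj a : exists p, a = hyp_pi r F p.
Proof. by exists (generic_quotient.repr a); rewrite /hyp_pi generic_quotient.reprK. Qed.

Definition hyp_iota : P -> A := mpoly_eval (xzt (hyp_x r F) (hyp_z r F) (hyp_t r F)).
HB.instance Definition _ := GRing.LRMorphism.on hyp_iota.

Lemma hyp_iota_varx i : hyp_iota (varx k i) = hyp_x r F i.
Proof. by rewrite /hyp_iota mpoly_evalX xzt_lshift. Qed.

Let widen_xzt : {lrmorphism P -> R} :=
  mpoly_eval (xzt (varX k (m := m)) (varZ k m) (varT k m)).
Let of_poly : {rmorphism {poly P} -> R} := poly_value widen_xzt (varY k m).

Let of_polyC b : of_poly b%:P = widen_xzt b. Proof. exact: poly_valueC. Qed.
Let of_polyX : of_poly 'X = varY k m. Proof. exact: poly_valueX. Qed.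

(** Indices 0, 1, 2 stand for Y, Z, T: Y becomes the outer variable, and Z, T move to places 0 and 1
    after the X_i in [P]. *)
Let yvar (j : 'I_3) : {poly P} :=
  if j == 0 then 'X else ('X_(rshift m (if j == 1 then 0 else 1 : 'I_2)))%:P.
Let to_poly_var (i : 'I_(m + 3)) : {poly P} :=
  match fintype.split i with inl j => (varx k j)%:P | inr j => yvar j end.
Let polyCC : {rmorphism k -> {poly P}} := polyC \o @mpolyC (m + 2) k.
Let to_poly : {rmorphism R -> {poly P}} := mpoly_lift polyCC to_poly_var.

Let to_polyX i : to_poly 'X_i = to_poly_var i.
Proof. by exact: mpoly_liftX. Qed.

Let to_poly_l i : to_poly (varX k i) = (varx k i)%:P.
Proof. by rewrite to_polyX /to_poly_var -[lshift 3 i]/(unsplit (inl i)) unsplitK. Qed.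

Let to_poly_r j : to_poly 'X_(rshift m j) = yvar j.
Proof. by rewrite to_polyX /to_poly_var -[rshift m j]/(unsplit (inr j)) unsplitK. Qed.

Let of_polyK : cancel of_poly to_poly.
Proof.
have widenE p : to_poly (widen_xzt p) = p%:P.
  apply: (mpoly_rmorph_eq (f := to_poly \o widen_xzt) (g := polyC)) => [c|i] /=.
    rewrite /widen_xzt mpoly_evalC -[c%:A]mul_mpolyC mulr1.
    by rewrite mpoly_liftC.
  rewrite -(splitK i) /widen_xzt mpoly_evalX; case: (fintype.split i) => j /=.
    by rewrite xzt_lshift to_poly_l.
  by rewrite xzt_rshift; case: j => [[|[|n]] lt2] //;
    rewrite to_poly_r; congr ('X_ _)%:P; apply: val_inj.
move=> Q; elim/poly_ind: Q => [|Q c IH]; first by rewrite !rmorph0.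
rewrite !(rmorphD, rmorphM) IH of_polyX of_polyC widenE.
by rewrite to_poly_r.
Qed.

Let hyp_pi_of_poly Q : hyp_pi r F (of_poly Q) = poly_value hyp_iota (hyp_y r F) Q.
Proof.
have widenE p : hyp_pi r F (widen_xzt p) = hyp_iota p.
  apply: (mpoly_lrmorph_eq (f := hyp_pi r F \o widen_xzt) (g := hyp_iota)) => i /=.
  rewrite /hyp_iota /widen_xzt !mpoly_evalX /xzt.
  by case: (fintype.split i) => // j; case: ifP.
elim/poly_ind: Q => [|Q c IH]; first by rewrite !rmorph0.
by rewrite !(rmorphD, rmorphM) /= IH of_polyX of_polyC poly_valueX poly_valueC widenE.
Qed.

Let of_poly_relator : of_poly ((xmon k r)%:P * 'X - F%:P) = relator r F.
Proof.
rewrite rmorphB rmorphM of_polyX !of_polyC rmorph_prod.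
congr (_ * _ - _); apply: eq_bigr => i _.
by rewrite rmorphXn /= /widen_xzt mpoly_evalX xzt_lshift.
Qed.

(** Separating Y from the other variables passes from k[X, Y, Z, T] to P[Y] and matches the relator
    with X^r Y - F, so surjectivity and kernel carry over from [hyp_pi]. *)
Lemma hyp_alg_pres : hyp_pres r F hyp_iota (hyp_y r F).
Proof.
split=> [a|Q].
  have [p ->] := hyp_pi_surj a; exists (to_poly p).
  apply: (mpoly_rmorph_eq (f := hyp_pi r F) (g := poly_value hyp_iota (hyp_y r F) \o to_poly)).
    move=> c /=; rewrite mpoly_liftC /= poly_valueC /= /hyp_iota mpoly_evalC.
    exact: (lrmorph_mpolyC (hyp_pi r F)).
  move=> {p} i /=; rewrite -(splitK i); case: (fintype.split i) => j /=.
    by rewrite to_poly_l poly_valueC; apply/esym/hyp_iota_varx.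
  rewrite to_poly_r /yvar; case: j => [[|[|[|n]]] lt3] //.
  - rewrite poly_valueX; congr (hyp_pi r F 'X_ _); exact: val_inj.
  - rewrite poly_valueC /= /hyp_iota mpoly_evalX xzt_rshift.
    congr (hyp_pi r F 'X_ _); exact: val_inj.
  - rewrite poly_valueC /= /hyp_iota mpoly_evalX xzt_rshift.
    congr (hyp_pi r F 'X_ _); exact: val_inj.
rewrite -hyp_pi_of_poly hyp_pi_eq0; split=> [[q /(congr1 to_poly)]|[S ->]].
  rewrite of_polyK rmorphM -of_poly_relator of_polyK => ->.
  by exists (to_poly q).
by exists (of_poly S); rewrite rmorphM of_poly_relator.
Qed.

Lemma hyp_BP a : hyp_B r F a <-> exists p, a = hyp_iota p.
Proof.
split.
  apply: (gen_subalg_sub (P := [set a | exists p, a = hyp_iota p])).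
    split=> [|c u v [p ->] [q ->]|u v [p ->] [q ->]].
    - by exists 1; rewrite rmorph1.
    - by exists (c *: p + q); rewrite linearP.
    - by exists (p * q); rewrite rmorphM.
  move=> _ [[i _ <-]|[] ->]; first by exists (varx k i); rewrite hyp_iota_varx.
    by exists 'X_(rshift m 0); rewrite /hyp_iota mpoly_evalX xzt_rshift.
  by exists 'X_(rshift m 1); rewrite /hyp_iota mpoly_evalX xzt_rshift.
case=> p ->.
have [B1 BZ BM] := gen_subalg_closed (range (hyp_x r F) `|` [set hyp_z r F; hyp_t r F]).
have BX i : hyp_B r F (hyp_iota 'X_i).
  apply: sub_gen_subalg; rewrite /hyp_iota mpoly_evalX /xzt.
  case: (fintype.split i) => j; first by left; exists j.
  by right; case: ifP => _; [left|right].
elim/mpolyind: p => [|c mu p _ _ IH].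
  (* The closure properties provide 1 and linear combinations; 0 is obtained as -1 + 1. *)
  have := BZ (-1) 1 1 B1 B1; rewrite scaleN1r addNr rmorph0; exact.
rewrite linearP; apply: (BZ) => //.
rewrite mpolyXE_id rmorph_prod; apply: big_ind => // i _.
rewrite rmorphXn /=; elim: (mu i) => [|e IHe]; first exact: B1.
by rewrite exprS; apply: (BM _ _ (BX i) IHe).
Qed.

Lemma hyp_alg_model : exists iota : {lrmorphism P -> A},
  [/\ hyp_pres r F iota (hyp_y r F),
      hyp_B r F = range iota,
      forall i, hyp_x r F i = iota (varx k i)
    & poly_at F (xzt (hyp_x r F) (hyp_z r F) (hyp_t r F)) = iota F].
Proof.
exists (hyp_iota : {lrmorphism P -> A}); split=> //.
- exact: hyp_alg_pres.
- apply/seteqP; split=> a; first by move=> /hyp_BP [p ->]; exists p.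
  by move=> [p _ <-]; apply/hyp_BP; exists p.
- by move=> i; rewrite [RHS]hyp_iota_varx.
Qed.

End HypersurfacePresentation.

(** With abstract presentations the two sides are interchangeable: each one-sided result is applied
    to [f] and to its inverse [g]. *)
Lemma hyp_pres_iso (k : fieldType) (m : nat) (r s : 'I_m -> nat)
    (F G : {mpoly k[m + 2]}) (A A' : comAlgType k)
    (iota : {lrmorphism {mpoly k[m + 2]} -> A}) (y : A)
    (iota' : {lrmorphism {mpoly k[m + 2]} -> A'}) (y' : A')
    (f : {lrmorphism A -> A'})
    (x : 'I_m -> A) (x' : 'I_m -> A') (B : set A) (B' : set A') (u : A) (u' : A') :
  hyp_pres r F iota y -> hyp_pres s G iota' y' ->
  (forall i, x i = iota (varx k i)) -> (forall i, x' i = iota' (varx k i)) ->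
  B = range iota -> B' = range iota' -> u = iota F -> u' = iota' G ->
  (0 < m)%N -> (forall i, 0 < r i)%N -> (forall i, 0 < s i)%N ->
  at_X0 F != 0 -> at_X0 G != 0 -> bijective f -> DK A = B -> DK A' = B' ->
  [/\ set_bij B B' f /\ set_bij (gen_subalg (range x)) (gen_subalg (range x')) f,
      (forall i : 'I_m, exists j : 'I_m,
          (exists2 lambda : k, lambda != 0 & f (x i) = lambda *: x' j) /\ r i = s j)
      /\ (exists sigma : 'S_m, forall i, r i = s (sigma i)),
      f @` ideal2 B (\prod_(i < m) x i ^+ r i) u =
        ideal2 B' (\prod_(i < m) x' i ^+ s i) u'
    & exists2 alpha : {lrmorphism {mpoly k[2]} -> {mpoly k[2]}},
        bijective alpha &
        exists2 lambda : k, lambda != 0 & alpha (at_X0 G) = lambda *: at_X0 F].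
Proof.
move=> presA presA' xE xE' -> -> -> -> m_gt0 r_gt0 s_gt0 F0 G0 f_bij DKF DKG.
have -> : \prod_(i < m) x i ^+ r i = iota (xmon k r).
  by rewrite rmorph_prod; apply: eq_bigr => i _; rewrite rmorphXn /= xE.
have -> : \prod_(i < m) x' i ^+ s i = iota' (xmon k s).
  by rewrite rmorph_prod; apply: eq_bigr => i _; rewrite rmorphXn /= xE'.
have [g fK gK] := lrmorph_inv f_bij.
have g_bij : bijective g by exact: Bijective gK fK.
(* The polynomial subrings are the Derksen invariants, which isomorphisms preserve. *)
have fB a : range iota a -> range iota' (f a).
  by rewrite -DKF -DKG; apply: DK_morph.
have gB a : range iota' a -> range iota (g a).
  by rewrite -DKF -DKG; apply: DK_morph.
have [b fb] : exists b : {lrmorphism {mpoly k[m + 2]} -> {mpoly k[m + 2]}},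
    forall p, f (iota p) = iota' (b p).
  by apply: exists_base_morph => i; have [q _ <-] := fB (iota 'X_i) (imageT _ _); exists q.
have [c gc] : exists c : {lrmorphism {mpoly k[m + 2]} -> {mpoly k[m + 2]}},
    forall p, g (iota' p) = iota (c p).
  by apply: exists_base_morph => i; have [q _ <-] := gB (iota' 'X_i) (imageT _ _); exists q.
have bK : cancel b c := base_morphK presA fK fb gc.
have cK : cancel c b := base_morphK presA' gK gc fb.
have [sigma bx] := base_morph_perm presA presA' G0 s_gt0 fK gK fb gc cK.
have cx i : exists2 l : k, l != 0 & c (varx k i) = l *: varx k (sigma^-1%g i).
  have [l l0 bxi] := bx (sigma^-1%g i); exists l^-1; rewrite ?invr_eq0 //.
  by have := congr1 c bxi; rewrite bK permKV linearZ => ->; rewrite scalerA mulVf ?scale1r.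
have DKFP a : DK A a -> exists p, a = iota p by rewrite DKF => -[p _ <-]; exists p.
have DKGP a : DK A' a -> exists p, a = iota' p by rewrite DKG => -[p _ <-]; exists p.
(* One inequality comes from [f], the other from [g]. *)
have rs i : r i = s (sigma i).
  have [l l0 bxi] := bx i; have [l' l'0] := cx (sigma i); rewrite permK => cxi.
  apply/eqP; rewrite eqn_leq.
  rewrite (exponent_leq presA presA' F0 r_gt0 fK fb gc DKFP l0 bxi) andbT.
  exact: (exponent_leq presA' presA G0 s_gt0 gK gc fb DKGP l'0 cxi).
have sr i : s i = r (sigma^-1%g i) by rewrite rs permKV.
have bmon := base_morph_xmon bx rs.
have cmon := base_morph_xmon cx sr.
have bij_of (X : set A) (Y : set A') :
    (forall a, X a -> Y (f a)) -> (forall a, Y a -> X (g a)) -> set_bij X Y f.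
  move=> XY YX; split=> //; first by move=> a b' _ _ /(can_inj fK).
  by move=> a /YX Xa; exists (g a); rewrite ?gK.
have E_scale (C : comAlgType k) (v : 'I_m -> C) (l : k) i :
    gen_subalg (range v) (l *: v i).
  have [E1 EZ _] := gen_subalg_closed (range v).
  have Ev : gen_subalg (range v) (v i) by apply: sub_gen_subalg; exists i.
  have E0 : gen_subalg (range v) 0.
    by have := EZ (-1) 1 1 E1 E1; rewrite scaleN1r addNr.
  by rewrite -[_ *: _]addr0; apply: EZ.
have fx i : exists2 l : k, l != 0 & f (x i) = l *: x' (sigma i).
  by have [l l0 bxi] := bx i; exists l; rewrite // xE xE' fb bxi linearZ.
have gx i : exists l : k, g (x' i) = l *: x (sigma^-1%g i).
  by have [l _ cxi] := cx i; exists l; rewrite xE xE' gc cxi linearZ.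
split.
- split; apply: bij_of => //; apply: gen_subalg_morph => _ [i _ <-].
    by have [l _ ->] := fx i; apply: E_scale.
  by have [l ->] := gx i; apply: E_scale.
- by split; [move=> i; exists (sigma i)|exists sigma].
- apply/seteqP; split=> [_ [_ [_ [_ [[p _ <-] [q _ <-] ->]]] <-]|].
    have [p' [q' E]] := base_morph_ideal presA presA' fb bmon p q.
    by exists (iota' p'), (iota' q'); split; [exact: imageT|exact: imageT|].
  move=> _ [_ [_ [[p _ <-] [q _ <-] ->]]].
  have [p' [q' E]] := base_morph_ideal presA' presA gc cmon p q.
  exists (g (iota' p * iota' (xmon k s) + iota' q * iota' G)); last by rewrite gK.
  by exists (iota p'), (iota q'); split; [exact: imageT|exact: imageT|].
(* As m >= 1, some variable occurs in X^r and X^s with positive exponent, so both vanish on X = 0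
   and only the multiples of F and G survive. *)
- pose i0 := Ordinal m_gt0.
  apply: (fibre_automorphism bK cK) => //.
  + by move=> i; have [l _ ->] := bx i; exists l, (sigma i).
  + by move=> i; have [l _ ->] := cx i; exists l, (sigma^-1%g i).
  + have [p [q ->]] := base_morph_F_xmon presA presA' fb bmon.
    by exists (fibre0 q); rewrite rmorphD !rmorphM /= (fibre0_xmon k (s_gt0 i0)) mul0r add0r.
  + have [p [q ->]] := base_morph_F_xmon presA' presA gc cmon.
    by exists (fibre0 q); rewrite rmorphD !rmorphM /= (fibre0_xmon k (r_gt0 i0)) mul0r add0r.
Qed.

Theorem theorem4p1 (k : fieldType) (m : nat) (r s : 'I_m -> nat)
    (F G : {mpoly k[m + 2]})
    (phi : {lrmorphism hyp_alg r F -> hyp_alg s G}) :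
  (1 <= m)%N ->
  (forall i, 1 < r i)%N -> (forall i, 1 < s i)%N ->
  at_X0 F != 0 -> at_X0 G != 0 ->
  bijective phi ->
  DK (hyp_alg r F) = hyp_B r F ->
  DK (hyp_alg s G) = hyp_B s G ->
  [/\ (* (i) *)
      set_bij (hyp_B r F) (hyp_B s G) phi
      /\ set_bij (hyp_E r F) (hyp_E s G) phi,
      (* (ii) *)
      (forall i : 'I_m, exists j : 'I_m,
          (exists2 lambda : k, lambda != 0 &
             phi (hyp_x r F i) = lambda *: hyp_x s G j)
          /\ r i = s j)
      /\ (exists sigma : 'S_m, forall i, r i = s (sigma i)),
      (* (iii) *)
      phi @` hyp_I r F = hyp_I s G
    & (* (iv) *)
      exists2 alpha : {lrmorphism {mpoly k[2]} -> {mpoly k[2]}},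
        bijective alpha &
        exists2 lambda : k, lambda != 0 &
          alpha (at_X0 G) = lambda *: at_X0 F].
Proof.
move=> m_gt0 r_gt1 s_gt1 F0 G0 phi_bij DKF DKG.
have [iota [presA BE xE FE]] := hyp_alg_model r F.
have [iota' [presA' BE' xE' GE]] := hyp_alg_model s G.
exact: (hyp_pres_iso presA presA' xE xE' BE BE' FE GE m_gt0
  (fun i => ltnW (r_gt1 i)) (fun i => ltnW (s_gt1 i)) F0 G0 phi_bij DKF DKG).
Qed.
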